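(* Let $(X,d)$ be a countably generated Lorentzian metric space, let $K$ be a compact subset of $X$, let $\sigma_n:[a_n,b_n]\to K$, $n\in\mathbb{N}$, be a sequence of continuous curves, and let $\sigma:[a,b]\to K$ be yet another continuous curve. The sequence $\sigma_n$ converges uniformly to $\sigma$ if and only if for each $z\in X$ the sequences of functions $d_z\circ\hat\sigma_n$ and $d^z\circ\hat\sigma_n$ converge uniformly to $d_z\circ\hat\sigma$ and $d^z\circ\hat\sigma$, respectively.
   Context: Let $X$ be a set and $d:X\times X\to[0,+\infty)$ a function. Notation: $d_x(y)=d^y(x)=d(x,y)$; $x\ll y$ iff $d(x,y)>0$; $I^+(x)=\{y: x\ll y\}$, $I^-(x)=\{y: y\ll x\}$; for $A\subset X$, $I^\pm(A)=\bigcup_{p\in A}I^\pm(p)$ and $I(A)=I^+(A)\cap I^-(A)$; $I(p,q):=I(\{p,q\})$. For $\epsilon>0$, $I_\epsilon=\{(x,y): d(x,y)\ge\epsilon\}$. $(X,d)$ is a Lorentzian metric space if: (i) $d(x,z)\ge d(x,y)+d(y,z)$ whenever $d(x,y)>0$ and $d(y,z)>0$; (ii) there is a topology $T$ on $X$ such that $d$ is continuous in the product topology and, for every $x,y\in X$ and $\epsilon>0$, the set $I_\epsilon\cap(\overline{I(x,y)}\times\overline{I(x,y)})$ is compact (the bar denotes closure in $T$); (iii) for all $x\ne y$ there is $z\in X$ with $d(x,z)\ne d(y,z)$ or $d(z,x)\ne d(z,y)$. It is countably generated if there is a countable $\mathscr{G}\subset X$ with $X=I(\mathscr{G})$; then the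 topology in (ii) is unique (and Polish) and $X$ is endowed with it. For a curve $\sigma:[a,b]\to X$, $\hat\sigma:\mathbb{R}\to X$ is the extension equal to $\sigma(a)$ for $s<a$, $\sigma(s)$ for $s\in[a,b]$, and $\sigma(b)$ for $s>b$. By definition, a sequence of continuous curves $\sigma_n:[a_n,b_n]\to X$ converges uniformly to a continuous curve $\sigma:[a,b]\to X$ if $a_n\to a$, $b_n\to b$ and $\hat\sigma_n\to\hat\sigma$ uniformly on $\mathbb{R}$; for curves with values in a compact set $K$ the uniformity used is the unique one on $K$ compatible with its topology (e.g. that of any metric inducing the topology). Uniform convergence of the real-valued functions $d_z\circ\hat\sigma_n$, $d^z\circ\hat\sigma_n$ is the usual uniform convergence of functions on $\mathbb{R}$.
   Formalization: Convergence of the endpoints a_n → a, b_n → b does not follow from the right-hand side (constant curves on [n,n+1]); it is added there, and the equivalence is also proved without endpoints for uniform convergence of the extended curves. *)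

(* Defs.v *)
From mathcomp Require Import all_boot all_order all_algebra.
From mathcomp Require Import all_classical all_reals all_analysis.

Set Implicit Arguments.
Unset Strict Implicit.
Unset Printing Implicit Defensive.

Import Order.TTheory GRing.Theory Num.Theory.
Import numFieldNormedType.Exports.

Local Open Scope classical_set_scope.
Local Open Scope ring_scope.

Definition chron_future {R : realType} {X : Type} (d : X -> X -> R) (x : X) :
  set X := [set y | 0 < d x y].

Definition chron_past {R : realType} {X : Type} (d : X -> X -> R) (x : X) :
  set X := [set y | 0 < d y x].

(* I(A) = I^+(A) `&` I^-(A); the two base points need not coincide. *)
Definition chron_hull {R : realType} {X : Type} (d : X -> X -> R) (A : set X) :
  set X :=
  (\bigcup_(p in A) chron_future d p) `&` (\bigcup_(p in A) chron_past d p).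

Definition dist_ge {R : realType} {X : Type} (d : X -> X -> R) (e : R) :
  set (X * X) := [set p | e <= d p.1 p.2].

(* The topology whose existence is required of a Lorentzian metric space is
   the one carried by X.  When the space is countably generated that topology
   is unique, so fixing it involves no choice. *)
Record lorentzian_metric {R : realType} {X : topologicalType}
    (d : X -> X -> R) : Prop := LorentzianMetric {
  lorentzian_ge0 : forall x y, 0 <= d x y ;
  lorentzian_reverse_triangle : forall x y z,
    0 < d x y -> 0 < d y z -> d x y + d y z <= d x z ;
  lorentzian_continuous : continuous (fun p : X * X => d p.1 p.2) ;
  lorentzian_compact : forall (x y : X) (e : R), 0 < e ->
    compact (dist_ge d e `&`
      (closure (chron_hull d [set x; y]) `*`
       closure (chron_hull d [set x; y]))) ;
  lorentzian_separated : forall x y : X, x <> y ->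
    exists z, d x z <> d y z \/ d z x <> d z y }.

Definition countably_generated {R : realType} {X : Type} (d : X -> X -> R) :
  Prop := exists2 G : set X, countable G & chron_hull d G = [set: X].

(* A uniformity on the subset K, presented as a filter on X * X containing
   K `*` K, which induces the subspace topology of K. *)
Record compatible_uniformity {X : topologicalType} (K : set X)
    (E : set_system (X * X)) : Prop := CompatibleUniformity {
  compat_filter : Filter E ;
  compat_support : E (K `*` K) ;
  compat_diagonal : forall A, E A -> forall x, K x -> A (x, x) ;
  compat_inv : forall A, E A -> E (A^-1)%relation ;
  compat_split : forall A, E A ->
    exists2 B, E B & (B \; B)%relation `<=` A ;
  compat_topology : forall x, K x -> forall V : set X,
    within K (nbhs x) V <-> exists2 A, E A & [set y | A (x, y)] `<=` V }.

(* Uniform convergence of K-valued maps.  A compact Hausdorff K has exactly one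
   compatible uniformity, so the quantifier over E is a definite description. *)
Definition compact_uniform_cvg {X : topologicalType} (K : set X) {T : Type}
    (f_ : nat -> T -> X) (f : T -> X) : Prop :=
  forall E : set_system (X * X), compatible_uniformity K E ->
  forall A, E A -> \forall n \near \oo, forall s, A (f s, f_ n s).

(* A curve on [a, b] is a total function on R whose values outside [a, b] are
   irrelevant. *)
Definition curve_in {R : realType} {X : topologicalType} (K : set X)
    (a b : R) (sigma : R -> X) : Prop :=
  [/\ a <= b, {within `[a, b], continuous sigma} & sigma @` `[a, b] `<=` K].

Definition curve_ext {R : realType} {X : Type} (a b : R) (sigma : R -> X) :
  R -> X :=
  fun s => if s < a then sigma a else if s <= b then sigma s else sigma b.

Definition curve_uniform_cvg {R : realType} {X : topologicalType} (K : set X)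
    (a_ b_ : nat -> R) (sigma_ : nat -> R -> X)
    (a b : R) (sigma : R -> X) : Prop :=
  [/\ a_ n @[n --> \oo] --> a, b_ n @[n --> \oo] --> b &
    compact_uniform_cvg K (fun n => curve_ext (a_ n) (b_ n) (sigma_ n))
      (curve_ext a b sigma)].

Definition distance_uniform_cvg {R : realType} {X : Type} (d : X -> X -> R)
    (f_ : nat -> R -> X) (f : R -> X) (z : X) : Prop :=
  {uniform, (fun n (s : R) => d z (f_ n s)) @ \oo --> (fun s : R => d z (f s))}
  /\
  {uniform, (fun n (s : R) => d (f_ n s) z) @ \oo --> (fun s : R => d (f s) z)}.

(* Main.v *)
Require Import Defs.
From mathcomp Require Import all_boot all_order all_algebra.
From mathcomp Require Import all_classical all_reals all_analysis.
From mathcomp Require Import lra.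

Set Implicit Arguments.
Unset Strict Implicit.
Unset Printing Implicit Defensive.

Import Order.TTheory GRing.Theory Num.Theory.
Import numFieldNormedType.Exports.

Local Open Scope classical_set_scope.
Local Open Scope ring_scope.

(** The functions d(z, .) and d(., z) are continuous and separate points, so on
    the compact set K the uniformity they induce is compatible with the topology
    and contains every compatible uniformity; uniform convergence in K therefore
    amounts to uniform convergence of each of these functions. *)

(** Each point of [C] either is a common zero, where [W] holds nearby by hypothesis, or has some
    [g j] bounded away from 0 around it, so that bounding [g j] by a small [e] excludes a whole
    neighbourhood. By compactness finitely many indices and one [e] suffice. *)
Lemma compact_near_zeros (R : realType) (T : topologicalType) (J : eqType)
    (g : J -> T -> R) (C W : set T) :
  compact C -> (forall j, continuous (g j)) ->
  (forall p, C p -> (forall j, g j p = 0) -> \forall x \near p, C x -> W x) ->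
  exists s : seq J, exists2 e : R, 0 < e &
    forall x, C x -> (forall j, j \in s -> `|g j x| < e) -> W x.
Proof.
move=> /compact_near_coveringP C_cov g_cont CW.
(* The sets [D i] are the tails for the order in which a pair grows by lengthening the list and
   shrinking the bound. They generate the filter [F] used in the near-covering form of
   compactness. *)
pose D (i : seq J * R) :=
  [set k : seq J * R | {subset i.1 <= k.1} /\ 0 < k.2 <= i.2].
pose F := filter_from [set i : seq J * R | 0 < i.2] D.
have FF : Filter F.
  apply: filter_from_filter; first by exists ([::], 1) => /=; exact: ltr01.
  move=> [s e] [t r] /= e0 r0; exists (s ++ t, Num.min e r) => /=.
    by rewrite lt_min e0 r0.
  move=> [u q] [/= su /andP[q0]]; rewrite le_min => /andP[qe qr].
  split; split=> /=; rewrite ?q0 // => x xs; apply: su;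
    by rewrite mem_cat xs ?orbT.
pose P (k : seq J * R) x :=
  C x -> (forall j, j \in k.1 -> `|g j x| < k.2) -> W x.
have [[s e] /= e0 sub] : \forall k \near F, C `<=` P k.
  apply: C_cov => p Cp.
  have [g0|/existsNP[j /eqP gj]] := pselect (forall j, g j p = 0).
    exists ([set x | C x -> W x], setT) => /=; first split=> //.
      exact: CW.
    exact: filterT.
    by move=> [x k] [/= CWx _] Cx _; exact: CWx.
  (* On this neighbourhood [P] is vacuous: [j] lies in every list of the tail, and every bound there
     is at most half of [|g j p|], hence below [|g j x|]. *)
  exists ([set x | `|g j p| / 2 < `|g j x|], D ([:: j], `|g j p| / 2)) => /=.
    split.
      have : `|g j x| @[x --> p] --> `|g j p| by apply: cvg_norm; exact: g_cont.
      move=> /cvgr_gt; apply.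
      have := normr_gt0 (g j p); rewrite gj; lra.
    exists ([:: j], `|g j p| / 2) => //=.
    by rewrite divr_gt0// normr_gt0.
  move=> [x [s e]] [/= gx [js /andP[_ ee]]] _ /(_ j (js _ (mem_head _ _))) /= ge.
  by have := lt_trans gx (lt_le_trans ge ee); rewrite ltxx.
exists s, e => // x Cx gx; apply: (sub (s, e)) => //=.
by split=> //; rewrite e0 lexx.
Qed.

(** The initial uniformity of the family [f] on [K], given by its basic entourages; only the part of
    [A] over [K] is constrained. *)
Definition induced_uniformity {R : realType} {X : Type} {J : eqType}
    (f : J -> X -> R) (K : set X) : set_system (X * X) :=
  [set A | exists s : seq J, exists2 e : R, 0 < e &
    forall p, (K `*` K) p -> (forall j, j \in s -> `|f j p.1 - f j p.2| < e) ->
      A p].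

Section separating_family.
Context {R : realType} {X : topologicalType} {J : eqType}.
Variables (f : J -> X -> R) (K : set X).
Hypothesis K_compact : compact K.
Hypothesis f_cont : forall j, continuous (f j).
Hypothesis f_sep : forall x y, K x -> K y -> (forall j, f j x = f j y) -> x = y.

(** Compactness and separation enter only in the topology clause: the functions [f j x - f j y] of
    [y] have no common zero in [K] but [x], so finitely many of them cut out a set inside any given
    neighbourhood of [x] in [K]. *)
Lemma induced_uniformity_compatible :
  compatible_uniformity K (induced_uniformity f K).
Proof.
split.
- split.
  + by exists [::], 1.
  + move=> A B [s [e e0 sA]] [t [r r0 tB]].
    exists (s ++ t), (Num.min e r); first by rewrite lt_min e0 r0.
    move=> p Kp H; split; [apply: sA => // j js|apply: tB => // j js];
      have := H j; by rewrite mem_cat js ?orbT lt_min => /(_ isT)/andP[].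
  + move=> A B AB [s [e e0 sA]]; exists s, e => // p Kp ps.
    exact/AB/sA.
- by exists [::], 1.
- move=> A [s [e e0 sA]] x Kx; apply: sA => // j _ /=.
  by rewrite subrr normr0.
- move=> A [s [e e0 sA]]; exists s, e => // -[x y] [/= Kx Ky] ps.
  by apply: (sA (y, x)) => //= j js; rewrite distrC; exact: ps.
- move=> A [s [e e0 sA]].
  exists [set p | (K `*` K) p /\
      forall j, j \in s -> `|f j p.1 - f j p.2| < e / 2].
    by exists s, (e / 2); rewrite ?divr_gt0.
  move=> [x z] [y /= [[/= Kx Ky] xy] [[/= _ Kz] yz]].
  apply: sA => // j js; rewrite (splitr e) /=.
  rewrite -(subrKA (f j y)); apply: (le_lt_trans (ler_normD _ _)).
  by rewrite ltrD// ?xy ?yz.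
- move=> x Kx V; split=> [xV|[A [s [e e0 sA]] AV]].
    have [||s [e e0 sV]] := @compact_near_zeros R X J
      (fun j y => f j x - f j y) K V K_compact.
    + by move=> j y; apply: cvgB; [exact: cvg_cst|exact: f_cont].
    + move=> y Ky fxy; suff <- : x = y by exact: xV.
      by apply: f_sep => // j; apply/eqP; rewrite -subr_eq0 fxy.
    (* This set has section [V] at [x] and is unconstrained at every other first coordinate. *)
    exists [set p | p.1 = x -> V p.2]; last by move=> y; exact.
    exists s, e => // -[u y] [/= _ Ky] H ux.
    by apply: sV => // j; rewrite -ux; exact: H.
  suff : \forall y \near x, forall j, j \in s -> `|f j x - f j y| < e.
    by apply: filterS => y H Ky; apply: AV; exact: sA.
  elim: s {sA} => [|i s IH]; first by near=> y => j; rewrite in_nil.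
  have fi : \forall y \near x, `|f i x - f i y| < e.
    by have /cvgrPdist_lt := @f_cont i x; exact.
  near=> y => j; rewrite inE => /predU1P[->|]; first by near: y.
  by move: j; near: y.
Unshelve. all: by end_near. Qed.

(** In [K] times [K] the common zeros of [f j p.1 - f j p.2] form the diagonal, and an entourage of
    [E] is a neighbourhood of each diagonal point, so [compact_near_zeros] applies on the
    product. *)
Lemma sub_induced_uniformity (E : set_system (X * X)) :
  compatible_uniformity K E -> E `<=` induced_uniformity f K.
Proof.
move=> Ecomp A EA.
refine (@compact_near_zeros R (X * X)%type J (fun j p => f j p.1 - f j p.2)
  (K `*` K) A (compact_setX K_compact K_compact) _ _).
  move=> j p; apply: cvgB.
    by apply: cvg_comp; [exact: cvg_fst|exact: f_cont].
  by apply: cvg_comp; [exact: cvg_snd|exact: f_cont].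
move=> [x y] [/= Kx Ky] fxy.
have {y Ky fxy} <- : x = y.
  by apply: f_sep => // j; apply/eqP; rewrite -subr_eq0 fxy.
have [B EB BA] := compat_split Ecomp EA.
(* Left and right sections of [B] at [x] are both neighbourhoods in [K], the left one through the
   inverse of [B]. Their product lies in [B \; B], passing through [x], hence in [A]. *)
have BV : within K (nbhs x) [set u | B (u, x)].
  apply/(compat_topology Ecomp Kx); exists (B^-1)%relation => //.
  exact: (compat_inv Ecomp EB).
have Bx : within K (nbhs x) [set v | B (x, v)].
  by apply/(compat_topology Ecomp Kx); exists B.
exists ([set u | K u -> B (u, x)], [set v | K v -> B (x, v)]); first by split.
move=> [u v] [/= Bu Bv] [/= Ku Kv]; apply: BA.
by exists x; [exact: Bu|exact: Bv].
Qed.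

(** Forwards, convergence is tested on the induced uniformity, which is compatible. Backwards, an
    entourage of any compatible uniformity contains a basic one, which involves only finitely many
    [j], so finitely many eventual bounds combine. *)
Lemma compact_uniform_cvgP (T : Type) (h_ : nat -> T -> X) (h : T -> X) :
  (forall n t, K (h_ n t)) -> (forall t, K (h t)) ->
  compact_uniform_cvg K h_ h <->
  (forall j (e : R), 0 < e ->
    \forall n \near \oo, forall t, `|f j (h t) - f j (h_ n t)| < e).
Proof.
move=> Kh_ Kh; split=> [h_cvg j e e0|h_cvg E Ecomp A EA].
  apply: (h_cvg _ induced_uniformity_compatible
    [set p | `|f j p.1 - f j p.2| < e]).
  by exists [:: j], e => // p _; apply; exact: mem_head.
have [s [e e0 sA]] := sub_induced_uniformity Ecomp EA.
suff : \forall n \near \oo, forall t j, j \in s ->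
    `|f j (h t) - f j (h_ n t)| < e.
  by apply: filterS => n H t; apply: sA => [|j]; [split=> /=|exact: H].
elim: s {sA} => [|i s IH]; first by near=> n => t j; rewrite in_nil.
have {}h_cvg := h_cvg i e e0.
near=> n => t j; rewrite inE => /predU1P[->|]; first by move: t; near: n.
by move: t j; near: n.
Unshelve. all: by end_near. Qed.

End separating_family.

Lemma uniform_cvgP (R : realType) (T : choiceType) (u_ : nat -> T -> R)
    (u : T -> R) :
  {uniform, u_ @ \oo --> u} <->
  forall e, 0 < e -> \forall n \near \oo, forall t, `|u t - u_ n t| < e.
Proof.
split=> [u_cvg e e0|u_cvg A /uniform_nbhs[E [entE EA]]].
  apply: (u_cvg [set v | forall t, `|u t - v t| < e]).
  apply/uniform_nbhs; exists [set p | `|p.1 - p.2| < e]; split.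
    exact: (entourage_ball _ (PosNum e0)).
  by move=> v /= H t; exact: H.
move: entE; rewrite -entourage_from_ballE => -[e /= e0 eE].
have := u_cvg e e0; apply: filterS => n H; apply: EA => t _.
exact/eE/H.
Qed.

Lemma curve_ext_in (R : realType) (X : topologicalType) (K : set X) (a b : R)
    (sigma : R -> X) :
  curve_in K a b sigma -> forall s, K (curve_ext a b sigma s).
Proof.
move=> [ab _ sK] s; rewrite /curve_ext.
case: ltP => [_|as_]; first by apply: sK; exists a; rewrite //= in_itv/= lexx.
case: leP => sb; apply: sK; last by exists b; rewrite //= in_itv/= ab lexx.
by exists s; rewrite //= in_itv/= as_.
Qed.

Theorem theorem5p7 (R : realType) (X : topologicalType) (d : X -> X -> R)
    (d_lorentzian : lorentzian_metric d) (d_gen : countably_generated d)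
    (K : set X) (K_compact : compact K)
    (a_ b_ : nat -> R) (sigma_ : nat -> R -> X)
    (sigma_curve : forall n, curve_in K (a_ n) (b_ n) (sigma_ n))
    (a b : R) (sigma : R -> X) (sigma_lim : curve_in K a b sigma) :
  let hsigma_ := fun n => curve_ext (a_ n) (b_ n) (sigma_ n) in
  let hsigma := curve_ext a b sigma in
  (compact_uniform_cvg K hsigma_ hsigma <->
     forall z : X, distance_uniform_cvg d hsigma_ hsigma z) /\
  (curve_uniform_cvg K a_ b_ sigma_ a b sigma <->
     [/\ a_ n @[n --> \oo] --> a, b_ n @[n --> \oo] --> b &
       forall z : X, distance_uniform_cvg d hsigma_ hsigma z]).
Proof.
move=> hsigma_ hsigma.
(* The limits of the endpoints occur on both sides of the second equivalence, which thus reduces to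
   the first. *)
suff main : compact_uniform_cvg K hsigma_ hsigma <->
    forall z : X, distance_uniform_cvg d hsigma_ hsigma z.
  split=> //.
  by split=> -[a_a b_b H]; split=> //; apply/main.
(* One family collects both kinds of distance functions: [true] selects [d z], and [false] the
   distance to [z]. *)
pose f (j : bool * X) x := if j.1 then d j.2 x else d x j.2.
have f_cont j : continuous (f j).
  case: j => -[] z x; rewrite /f /=.
    apply: (@continuous_comp _ _ _ (fun y => (z, y)) (fun p => d p.1 p.2)).
      by apply: cvg_pair; [exact: cvg_cst|exact: cvg_id].
    exact: (lorentzian_continuous d_lorentzian).
  apply: (@continuous_comp _ _ _ (fun y => (y, z)) (fun p => d p.1 p.2)).
    by apply: cvg_pair; [exact: cvg_id|exact: cvg_cst].
  exact: (lorentzian_continuous d_lorentzian).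
(* This is the separation axiom of a Lorentzian metric space, valid on all of [X]. *)
have f_sep x y : K x -> K y -> (forall j, f j x = f j y) -> x = y.
  move=> _ _ fxy; apply: contrapT => /(lorentzian_separated d_lorentzian)[z].
  by case; apply; [exact: (fxy (false, z))|exact: (fxy (true, z))].
rewrite (compact_uniform_cvgP K_compact f_cont f_sep); last 2 first.
- by move=> n; exact: curve_ext_in.
- exact: curve_ext_in.
split=> [H z|H [[] z]].
- by split; apply/uniform_cvgP; [exact: (H (true, z))|exact: (H (false, z))].
- exact/uniform_cvgP/(H z).1.
- exact/uniform_cvgP/(H z).2.
Qed.
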